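(* Let $J$ be an object of $G$, let $A\subseteq{}_J\mathcal{C}$, let $F:=\Pi\cap A^\perp$, and let $G'$ denote the full Brink-Howlett groupoid of $W_F$ (objects: all subsets of $F$; morphisms $K\to L$: triples $(L,w,K)$ with $w\in W_F$ and $w(K)=L$). Let $H:=\operatorname{Stab}_G(A)$ be the pointwise stabilizer groupoid of $A$ in $G$. Then: (a) $A\subseteq C$. (b) The pointwise stabilizer of $A$ in $W$ is $W_F$. (c) $H$ is equal to the full subgroupoid of $G'$ on the objects of $H$. (d) $H$ is a union of connected components of $G'$.
   Context: $\operatorname{span}(X)$ is the linear span, $\operatorname{cone}(X)$ the set of finite non-negative linear combinations of elements of $X$ (including $0$). $(V,B)$ is a real vector space with a symmetric bilinear form; $X^\perp=\{v\in V\mid B(v,x)=0\ \forall x\in X\}$; for $B(\alpha,\alpha)\neq 0$, $s_\alpha(v)=v-\frac{2B(v,\alpha)}{B(\alpha,\alpha)}\alpha$. $(\Phi,\Pi)$ is a based root system in $(V,B)$ with associated Coxeter system $(W,S)$: $\Pi\subseteq V$; $\operatorname{cone}(\Pi)\cap\operatorname{cone}(-\Pi)=\{0\}$; for all $\alpha\in\Pi$, $\alpha\notin\operatorname{cone}(\Pi\setminus\{\alpha\})$ and $B(\alpha,\alpha)=1$; $S=\{s_\alpha\mid\alpha\in\Pi\}$, $W=\langle S\rangle$; $\Phi=\{w\alpha\mid w\in W,\alpha\in\Pi\}$ satisfies $\Phi=\Phi^+\cup\Phi^-$ where $\Phi^{\pm}=\Phi\cap\operatorname{cone}(\pm\Pi)$.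 The rank may be infinite. For $J\subseteq\Pi$, $W_J=\langle s_\alpha\mid\alpha\in J\rangle$. Components of $J\subseteq\Pi$ are taken in the Coxeter graph on $\Pi$ (distinct $\alpha,\beta$ joined iff $s_\alpha s_\beta$ has order $\ge3$ or $\infty$); $J_{\mathrm{fin}}$ is the union of components of $J$ that generate finite groups. $C=\{v\in V\mid B(v,\alpha)\ge0\ \forall\alpha\in\Pi\}$ is the fundamental chamber of $(W,S)$ on $V$. The full Brink-Howlett groupoid of $(W,S)$ has as objects the subsets of $\Pi$; a morphism $J\to K$ is a triple $(K,w,J)$ with $w\in W$, $w(J)=K$; composition $(L,v,K)(K,w,J)=(L,vw,J)$. $G$ is a Brink-Howlett groupoid, i.e. a union of connected components of it. It is assumed that every object $J$ of $G$ satisfies: (i) for all $\alpha\in\Pi$, $B(\alpha,\beta)\neq0$ for only finitely many $\beta\in J_{\mathrm{fin}}$; (ii) $J=J_{\mathrm{fin}}$; (iii) $V=\operatorname{span}(J)\oplus J^\perp$. For $J\in\mathrm{ob}(G)$: ${}_J\mathcal{V}=J^\perp\subseteq V$, $B_J$ is the restriction of $B$ to $J^\perp$, $\pi_J\colon V\to J^\perp$ is the orthogonal projection, ${}_J\Delta=\{\pi_J(\alpha)\mid\alpha\in\Pi\setminus J\}$, and ${}_J\mathcal{C}=\{v\in{}_J\mathcal{V}\mid B_J(v,\alpha)\ge0\ \forall\alpha\in{}_J\Delta\}$. For $A\subseteq{}_J\mathcal{V}$, the pointwise stabilizer groupoid $\operatorname{Stab}_G(A)$ is the subgroupoid $H$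 of $G$ whose objects are the objects $K$ of $G$ with $A\subseteq K^\perp$, and whose morphisms $K\to L$ are the morphisms $(L,w,K)$ of $G$ (with $K,L\in\mathrm{ob}(H)$) such that $wa=a$ for all $a\in A$. *)

(* Defs.v *)
From Stdlib Require Import Relation_Operators.
From HB Require Import structures.
From mathcomp Require Import all_boot all_order all_algebra.
From mathcomp Require Import boolp classical_sets functions cardinality reals.

Set Implicit Arguments.
Unset Strict Implicit.
Unset Printing Implicit Defensive.

Import Order.TTheory GRing.Theory Num.Theory.

Local Open Scope classical_set_scope.
Local Open Scope ring_scope.

Section LinearHulls.
Variables (R : realType) (V : lmodType R) (X : set V).

Definition lin_span : set V :=
  [set v | exists n (c : 'I_n -> R) (x : 'I_n -> V),
     (forall i, X (x i)) /\ v = \sum_(i < n) c i *: x i].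

Definition cone : set V :=
  [set v | exists n (c : 'I_n -> R) (x : 'I_n -> V),
     (forall i, 0 <= c i /\ X (x i)) /\ v = \sum_(i < n) c i *: x i].

End LinearHulls.

Section Reflections.
Variables (R : realType) (V : lmodType R) (B : {symmetric V}).

Definition perp (X : set V) : set V :=
  [set v | forall x, X x -> B v x = 0].

Definition refl (a : V) : V -> V := fun v => v - (2 * B v a / B a a) *: a.

(* The subgroup W_J of Sym(V) generated by the s_a, a in J.  The last
   constructor is closure under inverses. *)
Inductive refl_group (J : set V) : (V -> V) -> Prop :=
| refl_group1 : refl_group J id
| refl_group_gen a : J a -> refl_group J (refl a)
| refl_groupM v w : refl_group J v -> refl_group J w -> refl_group J (v \o w)
| refl_groupV w w' :
    refl_group J w -> cancel w w' -> cancel w' w -> refl_group J w'.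

(* No hypothesis on B a a: if it is 0, then so is its inverse, and
   [refl a] is the identity. *)
Lemma reflK a : involutive (refl a).
Proof.
move=> v; rewrite /refl; have [Baa0|Baa0] := eqVneq (B a a) 0.
  by rewrite Baa0 invr0 !mulr0 !scale0r !subr0.
have -> : B (v - (2 * B v a / B a a) *: a) a = - B v a.
  by rewrite linearBl linearZl_LR /= mulfVK // mulr_natl mulr2n opprD addNKr.
by rewrite mulrN mulNr scaleNr opprK subrK.
Qed.

Lemma refl_group_bij (J : set V) w : refl_group J w ->
  exists w', [/\ refl_group J w', cancel w w' & cancel w' w].
Proof.
elim=> [|a Ja|v1 v2 _ [u1 [J1 K1 K1']] _ [u2 [J2 K2 K2']]|v v' Jv _ Kv Kv'].
- by exists id; split=> //; exact: refl_group1.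
- by exists (refl a); split; [exact: refl_group_gen|exact: reflK|exact: reflK].
- exists (u2 \o u1); split; [exact: refl_groupM|exact: can_comp|exact: can_comp].
- by exists v.
Qed.

(* a and b are joined in the Coxeter graph iff a != b and the order of
   s_a s_b is at least 3 or infinite, i.e. is neither 1 nor 2. *)
Definition coxeter_edge (a b : V) : Prop :=
  a <> b /\
  forall n, (0 < n < 3)%N -> iter n (refl a \o refl b) <> (id : V -> V).

(* Vertex sets of the connected components of the induced subgraph on J. *)
Definition components (J : set V) : set (set V) :=
  [set K | exists2 a, J a &
     K = [set b | clos_refl_trans V
                    (fun x y => [/\ J x, J y & coxeter_edge x y]) a b]].

Definition fin_part (J : set V) : set V :=
  \bigcup_(K in [set K | components J K /\ finite_set (refl_group K)]) K.

Record based_root_system (Phi Pi : set V) : Prop := BasedRootSystem {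
  brs_pointed : cone Pi `&` cone (-%R @` Pi) = [set 0];
  brs_extremal : forall a, Pi a -> ~ cone (Pi `\ a) a;
  brs_unit : forall a, Pi a -> B a a = 1;
  brs_roots : Phi = [set v | exists w a, [/\ refl_group Pi w, Pi a & v = w a]];
  brs_signs : Phi = (Phi `&` cone Pi) `|` (Phi `&` cone (-%R @` Pi)) }.

Definition chamber (Pi : set V) : set V :=
  [set v | forall a, Pi a -> 0 <= B v a].

(* V is the direct sum of span(J) and the orthogonal complement of J. *)
Definition span_perp_direct (J : set V) : Prop :=
  (forall v, exists x y, [/\ lin_span J x, perp J y & v = x + y]) /\
  lin_span J `&` perp J = [set 0].

(* Projection to [perp J] along [lin_span J]; when [span_perp_direct J]
   holds, [perp_proj J v] is the unique element of the set below. *)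
Definition perp_proj (J : set V) (v : V) : V :=
  xget 0 [set u | perp J u /\ lin_span J (v - u)].

Definition rel_simple (Pi J : set V) : set V := perp_proj J @` (Pi `\` J).

Definition rel_chamber (Pi J : set V) : set V :=
  [set v | perp J v /\ forall a, rel_simple Pi J a -> 0 <= B v a].

End Reflections.

(* Groupoids whose objects are subsets of V and whose morphisms J -> K are
   triples (K, w, J), where w is a self-map of V. *)
Section Groupoids.
Variable V : Type.

Record groupoid := Groupoid {
  gob : set (set V);
  gmor : set (set V * (V -> V) * set V);
  gmor_cod : forall K w J, gmor (K, w, J) -> gob K;
  gmor_dom : forall K w J, gmor (K, w, J) -> gob J;
  gmor1 : forall J, gob J -> gmor (J, id, J);
  gmorM : forall L v K w J,
    gmor (L, v, K) -> gmor (K, w, J) -> gmor (L, v \o w, J);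
  gmorV : forall K w J, gmor (K, w, J) ->
    exists w', [/\ gmor (J, w', K), cancel w w' & cancel w' w] }.

Lemma groupoid_eq G H : gob G = gob H -> gmor G = gmor H -> G = H.
Proof.
case: G H => [o m ? ? ? ? ?] [o' m' ? ? ? ? ?] /= eo em.
by subst o' m'; congr Groupoid; exact: Prop_irrelevance.
Qed.

Section FullSub.
Variables (G : groupoid) (X : set (set V)).

Definition full_sub_ob := gob G `&` X.
Definition full_sub_mor : set (set V * (V -> V) * set V) :=
  [set t | [/\ gmor G t, X t.1.1 & X t.2]].

Lemma full_sub_cod K w J : full_sub_mor (K, w, J) -> full_sub_ob K.
Proof. by case=> /= /gmor_cod. Qed.
Lemma full_sub_dom K w J : full_sub_mor (K, w, J) -> full_sub_ob J.
Proof. by case=> /= /gmor_dom. Qed.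
Lemma full_sub1 J : full_sub_ob J -> full_sub_mor (J, id, J).
Proof. by case=> /gmor1. Qed.
Lemma full_subM L v K w J :
  full_sub_mor (L, v, K) -> full_sub_mor (K, w, J) ->
  full_sub_mor (L, v \o w, J).
Proof. by move=> [/= vm XL _] [/= wm _ XJ]; split=> //; exact: gmorM wm. Qed.
Lemma full_subV K w J : full_sub_mor (K, w, J) ->
  exists w', [/\ full_sub_mor (J, w', K), cancel w w' & cancel w' w].
Proof. by move=> [/= /gmorV[w' [? ? ?]] XK XJ]; exists w'. Qed.

Definition full_sub : groupoid :=
  Groupoid full_sub_cod full_sub_dom full_sub1 full_subM full_subV.

End FullSub.

Definition component (G : groupoid) (J : set V) : groupoid :=
  full_sub G [set K | exists w, gmor G (K, w, J)].

Definition union_of_components (H G : groupoid) : Prop :=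
  exists X : set (set V),
    [/\ X `<=` gob G,
        gob H = \bigcup_(J in X) gob (component G J) &
        gmor H = \bigcup_(J in X) gmor (component G J)].

End Groupoids.

Section BrinkHowlett.
Variables (R : realType) (V : lmodType R) (B : {symmetric V}).

Section Full.
Variable F : set V.

Definition brink_howlett_ob : set (set V) := [set J | J `<=` F].
Definition brink_howlett_mor : set (set V * (V -> V) * set V) :=
  [set t | [/\ t.1.1 `<=` F, t.2 `<=` F, refl_group B F t.1.2 &
               t.1.2 @` t.2 = t.1.1]].

Lemma brink_howlett_cod K w J : brink_howlett_mor (K, w, J) -> brink_howlett_ob K.
Proof. by case. Qed.
Lemma brink_howlett_dom K w J : brink_howlett_mor (K, w, J) -> brink_howlett_ob J.
Proof. by case. Qed.
Lemma brink_howlett1 J : brink_howlett_ob J -> brink_howlett_mor (J, id, J).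
Proof. by move=> JF; split=> //=; [exact: refl_group1|exact: image_id]. Qed.
Lemma brink_howlettM L v K w J :
  brink_howlett_mor (L, v, K) -> brink_howlett_mor (K, w, J) ->
  brink_howlett_mor (L, v \o w, J).
Proof.
move=> [/= LF _ Wv vKL] [/= _ JF Ww wJK]; split=> //=.
  exact: refl_groupM.
by rewrite -image_comp wJK.
Qed.
Lemma brink_howlettV K w J : brink_howlett_mor (K, w, J) ->
  exists w', [/\ brink_howlett_mor (J, w', K), cancel w w' & cancel w' w].
Proof.
move=> [/= KF JF Ww wJK]; have [w' [Ww' ww' w'w]] := refl_group_bij Ww.
exists w'; split=> //; split=> //=.
rewrite -wJK image_comp (_ : w' \o w = id) ?image_id //.
by apply/funext => x /=; exact: ww'.
Qed.

(* The full Brink-Howlett groupoid of W_F. *)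
Definition brink_howlett : groupoid V :=
  Groupoid brink_howlett_cod brink_howlett_dom brink_howlett1
    brink_howlettM brink_howlettV.

End Full.

Section Stabilizer.
Variables (G : groupoid V) (A : set V).

Definition stab_ob : set (set V) := [set K | gob G K /\ A `<=` perp B K].
Definition stab_mor : set (set V * (V -> V) * set V) :=
  [set t | [/\ gmor G t, stab_ob t.1.1, stab_ob t.2 &
               forall a, A a -> t.1.2 a = a]].

Lemma stab_cod K w J : stab_mor (K, w, J) -> stab_ob K. Proof. by case. Qed.
Lemma stab_dom K w J : stab_mor (K, w, J) -> stab_ob J. Proof. by case. Qed.
Lemma stab1 J : stab_ob J -> stab_mor (J, id, J).
Proof. by move=> [GJ AJ]; split=> //; exact: gmor1. Qed.
Lemma stabM L v K w J :
  stab_mor (L, v, K) -> stab_mor (K, w, J) -> stab_mor (L, v \o w, J).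
Proof.
move=> [/= Gv oL _ vA] [/= Gw _ oJ wA]; split=> //=; first exact: gmorM Gw.
by move=> a Aa; rewrite wA // vA.
Qed.
Lemma stabV K w J : stab_mor (K, w, J) ->
  exists w', [/\ stab_mor (J, w', K), cancel w w' & cancel w' w].
Proof.
move=> [/= /gmorV[w' [Gw' ww' w'w]] oK oJ wA]; exists w'; split=> //.
by split=> //= a Aa; rewrite -{1}(wA a Aa) ww'.
Qed.

Definition stab_groupoid : groupoid V :=
  Groupoid stab_cod stab_dom stab1 stabM stabV.

End Stabilizer.

End BrinkHowlett.

(* Main.v *)
Require Import Defs.
From mathcomp Require Import all_boot all_order all_algebra.
From mathcomp Require Import boolp classical_sets functions cardinality reals.
From mathcomp Require Import ring.

(** Everything rests on (b), the description of the pointwise stabilizer in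
[W] of a subset [A] of the fundamental chamber (lemma [chamber_stabilizer]);
it holds for any subset of the chamber.

Part (a) is a computation: for [a] in the relative chamber of [J] and [alpha]
in [Pi \ J], the difference [alpha - pi_J alpha] lies in [span J], to which
[a] is orthogonal, so [B a alpha = B a (pi_J alpha) >= 0].

For (b), let [w = s_1 ... s_n] be a word in the simple reflections that fixes
[A] pointwise, and let [s_n = s_alpha].  If [w alpha] is negative, then for
each [a] in [A]

  [0 <= B a alpha = B (w a) (w alpha) = B a (w alpha) <= 0],

so [alpha] lies in [F], and [w s_n] is a shorter word that fixes [A].  If
[w alpha] is positive, then [s_1 ... s_(n-1)] sends [alpha] to a negative root
and the deletion condition ([refl_word_deletion]) rewrites [w] as a shorter
word.  Either way an induction on [n] concludes.  The deletion
condition holds because [alpha] is the only positive root that [s_alpha] makes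
negative ([simple_refl_pos]); this follows from the pointedness of [cone Pi]
and from [alpha] not lying in [cone (Pi \ {alpha})], so neither linear
independence of [Pi] nor finiteness of the rank is needed.

Parts (c) and (d) are formal: by (b), a morphism of the ambient groupoid fixes
[A] iff its group element lies in [W_F]; and if [K] is an object of [H] and
[w K = L] with [w] in [W_F] and [L] contained in [F], then [L] is an object of
[G], because [G] is a union of components, and it is orthogonal to [A]. *)

Set Implicit Arguments.
Unset Strict Implicit.
Unset Printing Implicit Defensive.

Import Order.TTheory GRing.Theory Num.Theory.

Local Open Scope classical_set_scope.
Local Open Scope ring_scope.

(** * Convex cones *)

Section Cone.
Variables (R : realType) (V : lmodType R).
Implicit Types (X : set V) (v : V) (c : R).

Lemma cone_ind X (P : V -> Prop) :
  P 0 -> (forall c x v, 0 <= c -> X x -> P v -> P (c *: x + v)) ->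
  forall v, cone X v -> P v.
Proof.
move=> P0 PS v [n [c [x [cx ->]]]].
by elim/big_rec: _ => // i u _ Pu; have [c0 Xx] := cx i; exact: PS.
Qed.

Lemma cone0 X : cone X 0.
Proof.
exists 0%N, (fun=> 0), (fun=> 0); split=> [[]//|].
by rewrite big_ord0.
Qed.

Lemma cone_cons X c x v : 0 <= c -> X x -> cone X v -> cone X (c *: x + v).
Proof.
move=> c0 Xx [n [d [y [dy ->]]]].
exists n.+1, (fun i => if unlift ord0 i is Some j then d j else c),
  (fun i => if unlift ord0 i is Some j then y j else x).
split=> [i|]; first by case: (unlift ord0 i).
rewrite big_ord_recl unlift_none; congr (_ + _).
by apply: eq_bigr => i _; rewrite liftK.
Qed.

Lemma coneD X u v : cone X u -> cone X v -> cone X (u + v).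
Proof.
move=> Xu Xv; move: u Xu; apply: cone_ind => [|c x u c0 Xx Xu].
  by rewrite add0r.
by rewrite -addrA; exact: cone_cons.
Qed.

Lemma coneZ X c v : 0 <= c -> cone X v -> cone X (c *: v).
Proof.
move=> c0; move: v; apply: cone_ind => [|d x u d0 Xx Xu].
  by rewrite scaler0; exact: cone0.
by rewrite scalerDr scalerA; apply: cone_cons => //; exact: mulr_ge0.
Qed.

Lemma sub_cone X x : X x -> cone X x.
Proof.
move=> Xx; rewrite -(addr0 x) -{1}(scale1r x).
by apply: cone_cons => //; exact: cone0.
Qed.

Lemma coneS X Y v : X `<=` Y -> cone X v -> cone Y v.
Proof.
move=> XY; move: v; apply: cone_ind => [|c x v c0 /XY Yx]; first exact: cone0.
exact: cone_cons.
Qed.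

Lemma coneN X v : cone (-%R @` X) v <-> cone X (- v).
Proof.
have H (Y Z : set V) u : (forall y, Y y -> Z (- y)) -> cone Y u -> cone Z (- u).
  move=> YZ; move: u; apply: cone_ind => [|c x u c0 /YZ Yx Yu].
    by rewrite oppr0; exact: cone0.
  by rewrite opprD -scalerN; exact: cone_cons.
split=> [|Xv]; first by apply: H => _ [x Xx <-]; rewrite opprK.
by rewrite -(opprK v); apply: H Xv => x Xx; exists x.
Qed.

(** Splitting off the coefficient of [a]. *)
Lemma coneD1 X a v : cone X v ->
  exists (p : R) (u : V), [/\ 0 <= p, cone (X `\ a) u & v = p *: a + u].
Proof.
move: v; apply: cone_ind => [|c x v c0 Xx [p [u [p0 Xu ->]]]].
  by exists 0, 0; split=> //; [exact: cone0|rewrite scale0r addr0].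
have [->|xa] := eqVneq x a.
  by exists (c + p), u; split; [exact: addr_ge0|by []|rewrite scalerDl addrA].
exists p, (c *: x + u); split=> //; last by rewrite addrCA.
by apply: cone_cons => //; split=> //; exact/eqP.
Qed.

End Cone.

(** * Words in reflections *)

Section Words.
Variables (R : realType) (V : lmodType R) (B : {symmetric V}).
Implicit Types (X : set V) (a u v : V) (s t : seq V).

Lemma formC u v : B u v = B v u.
Proof. by rewrite hermC expr0 mul1r. Qed.

Lemma reflD a u v : refl B a (u + v) = refl B a u + refl B a v.
Proof.
rewrite /refl linearDl mulrDr mulrDl scalerDl opprD.
by rewrite !addrA; congr (_ + _); rewrite addrAC.
Qed.

Lemma reflZ a (c : R) v : refl B a (c *: v) = c *: refl B a v.
Proof. by rewrite /refl linearZl_LR /= scalerBr scalerA mulrCA !mulrA. Qed.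

Lemma refl_orth a v : B v a = 0 -> refl B a v = v.
Proof. by move=> va; rewrite /refl va mulr0 mul0r scale0r subr0. Qed.

Lemma refl_isometry a u v : B a a = 1 -> B (refl B a u) (refl B a v) = B u v.
Proof.
move=> aa; rewrite /refl !linearBl !linearBr !linearZl_LR !linearZr_LR /=.
rewrite aa !divr1 !mulr1 (formC a v); ring.
Qed.

(** The product of the reflections in the entries of a word, the last letter
acting first. *)
Definition refl_word s v : V := foldr (refl B) v s.

Lemma refl_word_rcons s a v :
  refl_word (rcons s a) v = refl_word s (refl B a v).
Proof. by rewrite /refl_word foldr_rcons. Qed.

Lemma refl_wordD s u v : refl_word s (u + v) = refl_word s u + refl_word s v.
Proof. by elim: s => //= a s ->; exact: reflD. Qed.

Lemma refl_wordZ s (c : R) v : refl_word s (c *: v) = c *: refl_word s v.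
Proof. by elim: s => //= a s ->; exact: reflZ. Qed.

Lemma refl_wordN s v : refl_word s (- v) = - refl_word s v.
Proof. by rewrite -scaleN1r refl_wordZ scaleN1r. Qed.

Lemma refl_word_revK s : cancel (refl_word s) (refl_word (rev s)).
Proof.
elim: s => //= a s IH v; rewrite rev_cons refl_word_rcons.
by rewrite reflK IH.
Qed.

Lemma refl_groupP X (w : V -> V) :
  refl_group B X w <-> exists2 s, {in s, forall a, X a} & w = refl_word s.
Proof.
split=> [|[s + ->]]; last first.
  elim: s => [_|a s IH Xs]; first exact: refl_group1.
  apply: (@refl_groupM _ _ _ _ (refl B a) (refl_word s)).
    by apply: refl_group_gen; apply: Xs; exact: mem_head.
  by apply: IH => b bs; apply: Xs; rewrite inE bs orbT.
elim=> {w} [|a Xa|v w _ [s Xs ->] _ [t Xt ->]|w w' _ [s Xs ->] K K'].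
- by exists [::].
- by exists [:: a] => // b; rewrite inE => /eqP ->.
- exists (s ++ t); first by move=> b; rewrite mem_cat => /orP[/Xs|/Xt].
  by apply/funext => x; rewrite /refl_word foldr_cat.
- exists (rev s) => [b|]; first by rewrite mem_rev => /Xs.
  by apply/funext => x; rewrite -{2}(K' x) refl_word_revK.
Qed.

Lemma refl_groupS X Y w : X `<=` Y -> refl_group B X w -> refl_group B Y w.
Proof.
move=> XY /refl_groupP[s Xs ->]; apply/refl_groupP.
by exists s => // a /Xs /XY.
Qed.

Lemma refl_group_fix X w v :
  refl_group B X w -> (forall a, X a -> B v a = 0) -> w v = v.
Proof.
move=> /refl_groupP[s + ->] vX; elim: s => //= a s IH Xs.
rewrite IH => [|b bs]; last by apply: Xs; rewrite inE bs orbT.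
by apply: refl_orth; apply: vX; apply: Xs; exact: mem_head.
Qed.

Lemma refl_word_isometry s u v : {in s, forall b, B b b = 1} ->
  B (refl_word s u) (refl_word s v) = B u v.
Proof.
elim: s => //= b s IH s1; rewrite refl_isometry ?s1 ?mem_head //.
by apply: IH => c cs; rewrite s1 // inE cs orbT.
Qed.

(** Conjugation: [w s_a w^-1 = s_(w a)]. *)
Lemma refl_word_conj s a v : {in s, forall b, B b b = 1} ->
  refl_word s (refl B a v) = refl B (refl_word s a) (refl_word s v).
Proof.
move=> s1; rewrite /refl !refl_word_isometry //.
by rewrite refl_wordD refl_wordN refl_wordZ.
Qed.

End Words.

(** * The deletion condition and stabilizers *)

Section Roots.
Variables (R : realType) (V : lmodType R) (B : {symmetric V}).
Variables (Phi Pi : set V) (brs : based_root_system B Phi Pi).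
Implicit Types (a b v : V) (s t : seq V).

Lemma cone_pointed v : cone Pi v -> cone Pi (- v) -> v = 0.
Proof.
move=> Pv /coneN Nv; have : (cone Pi `&` cone (-%R @` Pi)) v by [].
by rewrite (brs_pointed brs).
Qed.

Lemma root_sign s a : {in s, forall b, Pi b} -> Pi a ->
  cone Pi (refl_word B s a) \/ cone Pi (- refl_word B s a).
Proof.
move=> Ps Pa; have : Phi (refl_word B s a).
  rewrite (brs_roots brs); exists (refl_word B s), a; split=> //.
  by apply/refl_groupP; exists s.
by rewrite (brs_signs brs) => -[[_ ?]|[_ /coneN ?]]; [left|right].
Qed.

Lemma simple_neq0 a : Pi a -> a <> 0.
Proof.
move=> Pa a0; have := brs_unit brs Pa; rewrite a0 linear0l.
by move/eqP; rewrite eq_sym oner_eq0.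
Qed.

(** The only positive unit vector that [s_a] makes negative is [a]. *)
Lemma simple_refl_pos a v : Pi a -> B v v = 1 ->
  cone Pi v -> cone Pi (- refl B a v) -> v = a.
Proof.
move=> Pa vv Pv; rewrite /refl (brs_unit brs Pa) divr1.
set c := 2 * B v a; set d := - _ => Pd.
have vd : v + d = c *: a by rewrite /d opprB addrCA subrr addr0.
have [p [x [p0 Px ev]]] := coneD1 a Pv.
have [q [y [q0 Py ed]]] := coneD1 a Pd.
have PD u : cone (Pi `\ a) u -> cone Pi u by apply: coneS => z [].
have exy : x + y = (c - p - q) *: a.
  by rewrite !scalerBl -vd ev ed -addrA -opprD addrACA [RHS]addrC addKr.
have [e0|e0] := ltP 0 (c - p - q).
  (* Here [a] would be a nonnegative combination of the other simple roots. *)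
  case: (brs_extremal brs Pa).
  have aE : a = (c - p - q)^-1 *: (x + y).
    by rewrite exy scalerA mulVf ?scale1r ?gt_eqF.
  rewrite [X in cone _ X]aE.
  by apply: coneZ; [rewrite invr_ge0 ltW|exact: coneD].
(* Pointedness of the cone kills the part of [v] outside the ray of [a]. *)
have x0 : x = 0.
  apply: cone_pointed; first exact: PD.
  have -> : - x = y + (- (c - p - q)) *: a.
    by rewrite scaleNr -exy opprD addrCA subrr addr0.
  apply: coneD; first exact: PD.
  by apply: coneZ; [rewrite oppr_ge0|exact: sub_cone].
move: vv; rewrite ev x0 addr0 linearZl_LR linearZr_LR /=.
rewrite (brs_unit brs Pa) mulr1.
move=> pp; have : p ^+ 2 == 1 by rewrite expr2 pp.
by rewrite sqrp_eq1 // => /eqP ->; rewrite scale1r.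
Qed.

(** If [w a] is negative, then a word for [w s_a] is obtained from one for [w]
by deleting a letter. *)
Lemma refl_word_deletion s a : {in s, forall b, Pi b} -> Pi a ->
  cone Pi (- refl_word B s a) ->
  exists t, [/\ (size t < size s)%N, {in t, forall b, Pi b} &
                refl_word B s \o refl B a = refl_word B t].
Proof.
move=> + Pa; elim: s => [_ Na|b s IH Ps Nw].
  by case: (simple_neq0 Pa); apply: cone_pointed => //; exact: sub_cone.
have Pb : Pi b by apply: Ps; exact: mem_head.
have {}Ps : {in s, forall c, Pi c}.
  by move=> c cs; apply: Ps; rewrite inE cs orbT.
have s1 : {in s, forall c, B c c = 1} by move=> c /Ps; exact: (brs_unit brs).
have [Pw|Nw'] := root_sign Ps Pa; last first.
  have [t [st Pt E]] := IH Ps Nw'; exists (b :: t); split=> //.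
    by move=> c; rewrite inE => /predU1P[->|/Pt].
  by apply/funext => v /=; rewrite -[refl_word B t v]/(_ v) -E.
(* The letter [b] is where [a] becomes negative, so [b = w a] for the word [w]
   to its right, and [s_b w s_a = w]. *)
have wab : refl_word B s a = b.
  apply: simple_refl_pos => //.
  by rewrite refl_word_isometry //; exact: (brs_unit brs).
exists s; split=> //; apply/funext => v /=.
by rewrite refl_word_conj // wab reflK.
Qed.

(** The pointwise stabilizer of a subset of the fundamental chamber is the
standard parabolic subgroup of the simple roots orthogonal to that subset. *)
Lemma chamber_stabilizer (A : set V) : A `<=` chamber B Pi ->
  [set w | refl_group B Pi w /\ forall a, A a -> w a = a]
  = refl_group B (Pi `&` perp B A).
Proof.
move=> AC; apply/seteqP; split=> w /=; last first.
  move=> Fw; split; first by apply: refl_groupS Fw => a [].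
  move=> a Aa; apply: refl_group_fix Fw _ => b [_ Ab].
  by rewrite formC; exact: Ab.
case=> /refl_groupP[s Ps ->] {w}; have [n] := ubnP (size s).
elim: n s Ps => // n IH s Ps.
case/lastP: s Ps => [_ _ _|s a Psa]; first exact: refl_group1.
rewrite size_rcons ltnS => sn fixA.
have Pa : Pi a by apply: Psa; rewrite mem_rcons mem_head.
have Ps : {in s, forall b, Pi b}.
  by move=> b bs; apply: Psa; rewrite mem_rcons inE bs orbT.
have wE : refl_word B (rcons s a) = refl_word B s \o refl B a.
  by apply/funext => v; rewrite refl_word_rcons.
have [Pw|Nw] := root_sign Ps Pa; last first.
  have [t [ts Pt E]] := refl_word_deletion Ps Pa Nw.
  rewrite wE E; apply: IH => // [|x Ax]; first exact: ltn_trans ts sn.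
  by rewrite -E -wE; exact: fixA.
have Ca u x : A x -> cone Pi u -> 0 <= B x u.
  move=> Ax; move: u; apply: cone_ind => [|c y u c0 Py u0].
    by rewrite linear0r.
  rewrite linearDr linearZr_LR /=; apply: addr_ge0 => //.
  by apply: mulr_ge0 => //; exact: AC.
have s1 : {in s, forall b, B b b = 1} by move=> b /Ps; exact: (brs_unit brs).
have Aa x : A x -> B x a = 0.
  move=> Ax; apply/eqP; rewrite eq_le (AC x Ax a Pa) andbT -oppr_ge0.
  (* With [u := s_1 ... s_(n-1)], the word being [u s_a]:
     [- B x a = B (s_a x) a = B (u (s_a x)) (u a) = B x (u a) >= 0]. *)
  have -> : - B x a = B (refl B a x) a.
    by rewrite /refl linearBl linearZl_LR /= (brs_unit brs Pa); field.
  by rewrite -(refl_word_isometry _ _ s1) -refl_word_rcons fixA //; exact: Ca.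
rewrite wE; apply: refl_groupM.
  apply: IH => // x Ax; have := fixA x Ax.
  by rewrite refl_word_rcons refl_orth //; exact: Aa.
by apply: refl_group_gen; split=> // x Ax; rewrite formC; exact: Aa.
Qed.

End Roots.

(** * Groupoids *)

Section Groupoids.
Variable V : Type.
Implicit Types (G : groupoid V) (K L : set V).

(** A union of components contains every morphism of the ambient groupoid that
starts at one of its objects. *)
Lemma union_of_components_mor H G K L w : union_of_components H G ->
  gob H K -> gmor G (L, w, K) -> gmor H (L, w, K).
Proof.
move=> [X [_ -> ->]] [I XI [GK [v Gv]]] Gw; exists I => //.
split=> //=; last by exists v.
by exists (w \o v); exact: gmorM Gw Gv.
Qed.

Lemma union_of_components_sub H G : union_of_components H G ->
  gob H `<=` gob G /\ gmor H `<=` gmor G.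
Proof.
by move=> [X [_ -> ->]]; split=> [K [I _ []]|t [I _ []]].
Qed.

(** A full subgroupoid is a union of components as soon as its set of objects
is closed under morphisms. *)
Lemma full_sub_components G (X : set (set V)) : X `<=` gob G ->
  (forall K L w, X K -> gmor G (L, w, K) -> X L) ->
  union_of_components (full_sub G X) G.
Proof.
move=> XG Xc; exists X; split=> //.
  apply/seteqP; split=> [K [GK XK]|L [K XK [GL [w Gw]]]].
    by exists K => //; split=> //; exists id; exact: gmor1.
  by split=> //; exact: Xc XK Gw.
apply/seteqP; split=> [[[L w] K] [/= Gw XL XK]|].
  exists K => //; split=> //=; first by exists w.
  by exists id; apply: gmor1; exact: XG.
move=> [[L w] K] [I XI [/= Gw [v Gv] [u Gu]]]; split=> //=.
  exact: Xc XI Gv.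
exact: Xc XI Gu.
Qed.

End Groupoids.

(** * The relative chamber *)

Section RelativeChamber.
Variables (R : realType) (V : lmodType R) (B : {symmetric V}).

Lemma perp_span (J : set V) u v : perp B J u -> lin_span J v -> B u v = 0.
Proof.
move=> Ju [n [c [x [Jx ->]]]]; rewrite linear_sumr big1 // => i _.
by rewrite linearZr_LR /= Ju ?mulr0.
Qed.

Lemma perp_projP (J : set V) v : span_perp_direct B J ->
  perp B J (perp_proj B J v) /\ lin_span J (v - perp_proj B J v).
Proof.
move=> [/(_ v)[x [y [Jx Jy vxy]]] _].
apply: (@xgetPex _ 0 [set u | perp B J u /\ lin_span J (v - u)]).
by exists y; split=> //; rewrite vxy addrK.
Qed.

Lemma rel_chamber_sub (Pi J : set V) : span_perp_direct B J ->
  rel_chamber B Pi J `<=` chamber B Pi.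
Proof.
move=> dJ v [Jv Cv] a Pa; have [Ja|nJa] := pselect (J a); first by rewrite Jv.
have [_ sa] := perp_projP a dJ.
have /eqP := perp_span Jv sa; rewrite linearBr subr_eq0 => /eqP ->.
by apply: Cv; exists a.
Qed.

End RelativeChamber.

Unset Implicit Arguments.


Theorem theorem1p67 (R : realType) (V : lmodType R) (B : {symmetric V})
    (Phi Pi : set V) (brs : based_root_system B Phi Pi)
    (G : groupoid V)
    (G_comp : union_of_components G (brink_howlett B Pi))
    (G_i : forall J, gob G J -> forall a, Pi a ->
       finite_set [set b | fin_part B J b /\ B a b <> 0])
    (G_ii : forall J, gob G J -> J = fin_part B J)
    (G_iii : forall J, gob G J -> span_perp_direct B J)
    (J : set V) (J_ob : gob G J)
    (A : set V) (A_chamber : A `<=` rel_chamber B Pi J) :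
  let F := Pi `&` perp B A in
  let G' := brink_howlett B F in
  let H := stab_groupoid B G A in
  [/\ (* (a) *) A `<=` chamber B Pi,
      (* (b) *) [set w | refl_group B Pi w /\ forall a, A a -> w a = a]
                = refl_group B F,
      (* (c) *) gob H `<=` gob G' /\ H = full_sub G' (gob H) &
      (* (d) *) union_of_components H G'].

Proof.
move=> F G' H.
have AC : A `<=` chamber B Pi.
  exact: subset_trans A_chamber (rel_chamber_sub (G_iii _ J_ob)).
have stabF := chamber_stabilizer brs AC.
have [GoP GmP] := union_of_components_sub G_comp.
have FP w : refl_group B F w -> refl_group B Pi w.
  by apply: refl_groupS => a [].
have perpS K : A `<=` perp B K <-> K `<=` perp B A.
  by split=> KA x Kx y Ay; rewrite formC; exact: KA.
have HF : gob H `<=` gob G'.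
  by move=> K [/GoP KP /perpS KA] x Kx; split; [exact: KP|exact: KA].
have HE : H = full_sub G' (gob H).
  apply: groupoid_eq.
    by apply/seteqP; split=> [K HK|K []//]; split=> //; exact: HF.
  apply/seteqP; split=> [[[L w] K] [/= Gw HL HK wA]|[[L w] K] [/= G'w HL HK]].
    have [_ _ Ww wK] := GmP _ Gw.
    split=> //; split=> //=; [exact: HF|exact: HF|].
    by rewrite -stabF.
  have [/= LF KF Fw wK] := G'w; split=> //=.
    apply: union_of_components_mor G_comp (HK.1) _; split=> //=.
    - by move=> x /LF[].
    - by move=> x /KF[].
    - exact: FP.
  by move: Fw; rewrite -stabF => -[].
split=> //; rewrite HE; apply: full_sub_components => // K L w [GK AK].
case=> /= LF KF Fw wK; split; last by apply/perpS => x /LF[].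
suff : gmor G (L, w, K) by exact: gmor_cod.
apply: union_of_components_mor G_comp GK _; split=> //=.
- by move=> x /LF[].
- by move=> x /KF[].
- exact: FP.
Qed.
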